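(* Let $f=\mathcal{I}(F):U\to\mathbb{H}$ be a slice regular function, $F=F_0+\sqrt{-1}F_1$ with $F_0,F_1:\mathcal{U}\to\mathbb{H}$. Suppose that $q=\pi(z,I)\in U$ (with $z\in\mathcal{U}$, $I\in\mathbb{S}$) is such that $\mathrm{Im}(z)\neq0$, $F_1(z)\neq0$ and the real differential $Df_q$ is singular. Then $F(\mathcal{U})$ is tangent to $Z_{f(q)}$ in $F(z)$.
   Context: $\mathbb{H}$ is the algebra of quaternions and $\mathbb{S}=\{I\in\mathbb{H}: I^2=-1\}$. For $z\in\mathbb{C}$, $I\in\mathbb{S}$ put $\pi(z,I)=\mathrm{Re}(z)+I\,\mathrm{Im}(z)\in\mathbb{H}$. Elements of the real tensor product $\mathbb{C}\otimes\mathbb{H}$ are written $w=w_0+\sqrt{-1}\,w_1$ with $w_0,w_1\in\mathbb{H}$; put $\overline{w}=w_0-\sqrt{-1}\,w_1$ and $\pi(w,I)=w_0+Iw_1$. The complex structure on $\mathbb{C}\otimes\mathbb{H}\cong\mathbb{C}^4$ is multiplication by $\sqrt{-1}$. Let $\mathcal{U}\subset\mathbb{C}$ be an open set with $\overline{\mathcal{U}}=\mathcal{U}$ and $U=\pi(\mathcal{U}\times\mathbb{S})$. A stem function is a map $F:\mathcal{U}\to\mathbb{C}\otimes\mathbb{H}$ with $F(\overline z)=\overline{F(z)}$; it induces the slice function $f=\mathcal{I}(F):U\to\mathbb{H}$, $f(\pi(z,I))=\pi(F(z),I)$. If $F$ is holomorphic, $f$ is called slice regular. For $p\in\mathbb{H}$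 put $Z_p=\{w\in\mathbb{C}\otimes\mathbb{H}:\ \pi(w,I)=p\text{ for some }I\in\mathbb{S}\}$. In the coordinates $w=(z_0,z_1,z_2,z_3)\in\mathbb{C}^4$ (basis $1\otimes1,1\otimes i,1\otimes j,1\otimes k$), if $p=p_0+p_1i+p_2j+p_3k$, then $Z_p$ is the complex quadratic cone $\sum_{h=0}^3(z_h-p_h)^2=0$, whose only singular point is its vertex $p$ (its only point with $w_1=0$). ''$F(\mathcal{U})$ is tangent to $Z_p$ in $F(z)$'' (where $F(z)\in Z_p$ is not the vertex) means that $DF_z[v]\in T_{F(z)}Z_p$ for all $v\in T_z\mathbb{C}$; in particular, the case $F(\mathcal{U})\subseteq Z_p$ counts as tangency. *)

(* Defs.v *)
From mathcomp Require Import all_boot all_order all_algebra.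
From mathcomp Require Import all_classical all_reals all_analysis.
From mathcomp Require Import complex.
Import Order.TTheory GRing.Theory Num.Theory.
Import numFieldNormedType.Exports.

Set Implicit Arguments.
Unset Strict Implicit.
Unset Printing Implicit Defensive.

Local Open Scope classical_set_scope.
Local Open Scope complex_scope.
Local Open Scope ring_scope.

(* The normed-module structure of the complex numbers over themselves is
   carried by the regular module R[i]^o, hence the ^o below. *)
Notation Cplx R := ((R[i])^o) (only parsing).

(* H in the real basis (1, i, j, k).  MathComp-Analysis gives row vectors the
   max norm; openness and differentials do not depend on this choice. *)
Notation quat R := 'rV[R]_4 (only parsing).

(* The real tensor product of C and H, in the complex basis
   (1 (x) 1, 1 (x) i, 1 (x) j, 1 (x) k). *)
Notation cquat R := 'rV[R[i]]_4 (only parsing).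

Section Quaternions.
Variable R : realType.

Definition mkquat (a b c d : R) : quat R := \row_(h < 4) [:: a; b; c; d]`_h.

Definition qone : quat R := mkquat 1 0 0 0.

Definition qmul (p q : quat R) : quat R :=
  mkquat
    (p 0 0 * q 0 0 - p 0 1 * q 0 1 - p 0 2 * q 0 2 - p 0 3 * q 0 3)
    (p 0 0 * q 0 1 + p 0 1 * q 0 0 + p 0 2 * q 0 3 - p 0 3 * q 0 2)
    (p 0 0 * q 0 2 - p 0 1 * q 0 3 + p 0 2 * q 0 0 + p 0 3 * q 0 1)
    (p 0 0 * q 0 3 + p 0 1 * q 0 2 - p 0 2 * q 0 1 + p 0 3 * q 0 0).

Definition imag_units : set (quat R) := [set I | qmul I I = - qone].

(* w = w_0 + sqrt(-1) w_1 with w_0 = cq_re w and w_1 = cq_im w *)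
Definition cq_re (w : cquat R) : quat R := map_mx (@complex.Re R) w.
Definition cq_im (w : cquat R) : quat R := map_mx (@complex.Im R) w.
Definition cq_conj (w : cquat R) : cquat R := map_mx (@conjc R) w.
Definition cq_of_quat (p : quat R) : cquat R := map_mx (fun x => x%:C) p.

Definition pi_C (z : Cplx R) (I : quat R) : quat R :=
  complex.Re z *: qone + complex.Im z *: I.

Definition pi_CH (w : cquat R) (I : quat R) : quat R :=
  cq_re w + qmul I (cq_im w).

End Quaternions.

Section SliceFunctions.
Variable R : realType.
Implicit Types (U : set (Cplx R)) (F : Cplx R -> cquat R).

Definition conj_invariant U := [set z | U (conjc z)] = U.

Definition stem_function U F :=
  forall z, U z -> F (conjc z) = cq_conj (F z).

(* complex differentiability *)
Definition holomorphic_on U F := forall z, U z -> derivable F z 1.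

(* f agrees with I(F) on pi(U x S); its values elsewhere are irrelevant *)
Definition induces U F (f : quat R -> quat R) :=
  forall (z : Cplx R) (I : quat R), U z -> imag_units I -> f (pi_C z I) = pi_CH (F z) I.

Definition slice_regular U F (f : quat R -> quat R) :=
  [/\ stem_function U F, holomorphic_on U F & induces U F f].

End SliceFunctions.

Section Tangency.
Variable R : realType.

Definition Zcone (p : quat R) : set (cquat R) :=
  [set w | exists2 I, imag_units I & pi_CH w I = p].

(* Velocities at 0 of the holomorphic arcs in Z through w; at a smooth point
   of a complex hypersurface Z this is the tangent space T_w Z. *)
Definition tangent_space (Z : set (cquat R)) (w : cquat R) : set (cquat R) :=
  [set u | exists gamma : Cplx R -> cquat R,
    [/\ gamma 0 = w,
        \forall t \near (0 : Cplx R), derivable gamma t 1 /\ Z (gamma t)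
      & is_derive (0 : Cplx R) 1 gamma u]].

Definition tangent_at (F : Cplx R -> cquat R) (p : quat R) (z : Cplx R) :=
  [/\ Zcone p (F z),
      F z != cq_of_quat p
    & forall v : Cplx R, tangent_space (Zcone p) (F z) ('d F z v)].

End Tangency.

(* Main.v *)
Require Import Defs.
From HB Require Import structures.
From mathcomp Require Import all_boot all_order all_algebra.
From mathcomp Require Import all_classical all_reals all_analysis.
From mathcomp Require Import complex.
From mathcomp Require Import ring lra.
Import Order.TTheory GRing.Theory Num.Theory.
Import numFieldNormedType.Exports.

Set Implicit Arguments.
Unset Strict Implicit.
Unset Printing Implicit Defensive.

Local Open Scope classical_set_scope.
Local Open Scope ring_scope.

(** The differential of f at q = pi(z, I) can be written down.  Split a
    quaternion v as v = (a + cI) + y, with a + cI in the plane C_I spanned by 1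
    and I, and y orthogonal to that plane.  Moving inside C_I moves only the
    argument of F; moving orthogonally turns only the imaginary unit.  Hence,
    with u = F'(z), A = pi(u, I), F_1 = F_1(z) and b = Im z,

      Df_q v = (a + cI) A + b^-1 y F_1

    ([is_diff_slice_regular]).  Since f is differentiable at q, a singular
    Jacobian does give some v != 0 with Df_q v = 0.  There a + cI is nonzero,
    as F_1 is invertible, and (a + cI) A = - b^-1 y F_1.  Multiplication by F_1
    on the right is a similarity, and y is orthogonal to 1 and I, so y F_1 is
    orthogonal to F_1 and to I F_1.  These two quaternions span a left C_I-line,
    hence A is orthogonal to both ([slice_diff_kernel]).

    On the other side, Z_p is the null cone of the complex quadratic form
    sum_h (z_h - p_h)^2 ([ZconeP]), and for p = f(q) the complex number
    sum_h u_h (F(z)_h - p_h) has the two scalar products of A with I F_1 and F_1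
    as real and imaginary parts, up to sign ([dot_cone]).  So u is orthogonal to
    F(z) - p.  Such a vector is the velocity of an explicit polynomial arc drawn
    on the cone ([orthogonal_tangent]), which is tangency. *)

(** * Coordinates in dimension four *)

Section Dot.
Variable K : comPzRingType.
Implicit Types u v w : 'rV[K]_4.

Definition dot u v : K := \sum_(h < 4) u 0 h * v 0 h.

Lemma sum_ord4 (V : nmodType) (g : 'I_4 -> V) :
  \sum_(h < 4) g h = g 0 + g 1 + g 2 + g 3.
Proof.
rewrite !big_ord_recl big_ord0 addr0 !addrA.
by congr (_ + _ + _ + _); congr g; apply: val_inj.
Qed.

Lemma forall_ord4 (P : 'I_4 -> Prop) :
  P 0 -> P 1 -> P 2 -> P 3 -> forall h, P h.
Proof.
move=> P0 P1 P2 P3 [[|[|[|[|//]]]] h4].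
- by rewrite (_ : Ordinal h4 = 0) //; apply: val_inj.
- by rewrite (_ : Ordinal h4 = 1) //; apply: val_inj.
- by rewrite (_ : Ordinal h4 = 2) //; apply: val_inj.
- by rewrite (_ : Ordinal h4 = 3) //; apply: val_inj.
Qed.

Lemma row4P u v : u 0 0 = v 0 0 -> u 0 1 = v 0 1 -> u 0 2 = v 0 2 ->
  u 0 3 = v 0 3 -> u = v.
Proof. by move=> *; apply/rowP; apply: forall_ord4. Qed.

Lemma dotE u v : dot u v =
  u 0 0 * v 0 0 + u 0 1 * v 0 1 + u 0 2 * v 0 2 + u 0 3 * v 0 3.
Proof. exact: sum_ord4. Qed.

Lemma dotC u v : dot u v = dot v u.
Proof. by apply: eq_bigr => h _; rewrite mulrC. Qed.

Lemma dotDl u v w : dot (u + v) w = dot u w + dot v w.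
Proof. by rewrite -big_split; apply: eq_bigr => h _; rewrite mxE mulrDl. Qed.

Lemma dotZl a u v : dot (a *: u) v = a * dot u v.
Proof. by rewrite mulr_sumr; apply: eq_bigr => h _; rewrite mxE mulrA. Qed.

Lemma dotDr u v w : dot u (v + w) = dot u v + dot u w.
Proof. by rewrite !(dotC u) dotDl. Qed.

Lemma dotZr a u v : dot u (a *: v) = a * dot u v.
Proof. by rewrite !(dotC u) dotZl. Qed.

Lemma dotNl u v : dot (- u) v = - dot u v.
Proof. by rewrite -scaleN1r dotZl mulN1r. Qed.

Lemma dotNr u v : dot u (- v) = - dot u v.
Proof. by rewrite !(dotC u) dotNl. Qed.

End Dot.

(** * Quaternion algebra *)

Section Quat.
Variable R : realType.
Implicit Types p q r I : 'rV[R]_4.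

Lemma mkquatE (a b c d : R) :
  (mkquat a b c d 0 0 = a) * (mkquat a b c d 0 1 = b) *
  (mkquat a b c d 0 2 = c) * (mkquat a b c d 0 3 = d).
Proof. by rewrite /mkquat !mxE. Qed.

Lemma dot_eq0 p : (dot p p == 0) = (p == 0).
Proof.
apply/idP/eqP => [|->]; last by rewrite dotE !mxE !mul0r !addr0.
rewrite psumr_eq0; last by move=> h _; rewrite -expr2 sqr_ge0.
move=> /allP p0; apply/rowP => h; rewrite mxE.
by have := p0 h (mem_index_enum _); rewrite /= mulf_eq0 orbb => /eqP.
Qed.

Definition qconj p : 'rV[R]_4 := mkquat (p 0 0) (- p 0 1) (- p 0 2) (- p 0 3).

Ltac quat_ring := rewrite ?dotE /qmul /qconj /qone ?(mkquatE, mxE); ring.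

Lemma qmulA p q r : qmul p (qmul q r) = qmul (qmul p q) r.
Proof. by apply: row4P; quat_ring. Qed.

Lemma qmulDr p q r : qmul p (q + r) = qmul p q + qmul p r.
Proof. by apply: row4P; quat_ring. Qed.

Lemma qmulZr a p q : qmul p (a *: q) = a *: qmul p q.
Proof. by apply: row4P; quat_ring. Qed.

Lemma qmulZl a p q : qmul (a *: p) q = a *: qmul p q.
Proof. by apply: row4P; quat_ring. Qed.

Lemma qmulN1 p : qmul (- qone R) p = - p.
Proof. by apply: row4P; quat_ring. Qed.

Lemma qmulr1 p : qmul p (qone R) = p.
Proof. by apply: row4P; quat_ring. Qed.

Lemma qmulJr p : qmul (qconj p) p = dot p p *: qone R.
Proof. by apply: row4P; quat_ring. Qed.

Lemma qmulJ_re p q : qmul p (qconj q) 0 0 = dot p q.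
Proof. quat_ring. Qed.

Lemma dot_qconj p : dot (qconj p) (qconj p) = dot p p.
Proof. quat_ring. Qed.

Lemma dot_qmul p q : dot (qmul p q) (qmul p q) = dot p p * dot q q.
Proof. quat_ring. Qed.

(** This and the next two lemmas are polarisations of [dot_qmul]: a
    multiplication, on either side, scales the scalar product. *)
Lemma dot_qmulr p q r : dot (qmul p r) (qmul q r) = dot p q * dot r r.
Proof. quat_ring. Qed.

Lemma dot_qmul_id p q : dot (qmul p q) q = p 0 0 * dot q q.
Proof. quat_ring. Qed.

Lemma dot_qmull p q r : dot (qmul p q) (qmul p r) = dot p p * dot q r.
Proof. quat_ring. Qed.

Lemma dot_qmul_im p q r : p 0 0 = 0 -> dot (qmul p q) r = - dot q (qmul p r).
Proof. move=> p0; rewrite !dotE /qmul !mkquatE p0; ring. Qed.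

(** By Cayley-Hamilton, I^2 = 2 Re(I) I - |I|^2, so I^2 = -1 forces Re(I) = 0:
    otherwise I would be real, with a negative square. *)
Lemma imag_unitsP I : imag_units I <-> I 0 0 = 0 /\ dot I I = 1.
Proof.
have IIE : qmul I I = (2 * I 0 0) *: I - dot I I *: qone R.
  by apply: row4P; quat_ring.
rewrite /imag_units /=; split=> [II|[I0 I1]]; last first.
  by rewrite IIE I0 I1 mulr0 scale0r scale1r sub0r.
have I0 : I 0 0 = 0.
  apply/eqP; apply: contraT => I0.
  have eqI : (2 * I 0 0) *: I = (dot I I - 1) *: qone R.
    by apply/eqP; rewrite scalerBl scale1r addrC -subr_eq -IIE II.
  have Ih (h : 'I_4) : qone R 0 h = 0 -> I 0 h = 0.
    move=> h0; have /rowP/(_ h) := eqI.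
    rewrite [LHS]mxE [RHS]mxE h0 mulr0 => /eqP.
    by rewrite !mulf_eq0 pnatr_eq0 (negPf I0) /= => /eqP.
  have /rowP/(_ 0) := II.
  rewrite /qmul /qone !(mxE, mkquatE) /= (Ih 1) ?(Ih 2) ?(Ih 3) ?mkquatE //.
  rewrite !mul0r !subr0 => II0.
  by have := sqr_ge0 (I 0 0); rewrite expr2 II0 ler0N1.
split=> //; have /rowP/(_ 0) := II.
rewrite IIE I0 mulr0 scale0r sub0r /qone !mxE /= !mulr1.
by move/oppr_inj.
Qed.

End Quat.

(** * The null cone and its tangent vectors *)

Section Cone.
Variable R : realType.
Local Open Scope complex_scope.
Implicit Types (p : 'rV[R]_4) (u w n m : 'rV[R[i]]_4).

Lemma ReM (x y : R[i]) : complex.Re (x * y) =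
  complex.Re x * complex.Re y - complex.Im x * complex.Im y.
Proof. by case: x; case: y. Qed.

Lemma ImM (x y : R[i]) : complex.Im (x * y) =
  complex.Re x * complex.Im y + complex.Im x * complex.Re y.
Proof. by case: x; case: y. Qed.

Lemma ReD (x y : R[i]) : complex.Re (x + y) = complex.Re x + complex.Re y.
Proof. by case: x; case: y. Qed.

Lemma ImD (x y : R[i]) : complex.Im (x + y) = complex.Im x + complex.Im y.
Proof. by case: x; case: y. Qed.

Lemma cq_reZ (a : R[i]) u :
  cq_re (a *: u) = complex.Re a *: cq_re u - complex.Im a *: cq_im u.
Proof. by apply/rowP => h; rewrite !mxE ReM. Qed.

Lemma cq_imZ (a : R[i]) u :
  cq_im (a *: u) = complex.Re a *: cq_im u + complex.Im a *: cq_re u.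
Proof. by apply/rowP => h; rewrite !mxE ImM. Qed.

Lemma cq_reB u p : cq_re (u - cq_of_quat p) = cq_re u - p.
Proof. by apply/rowP => h; rewrite !mxE /=; case: (u 0 h). Qed.

Lemma cq_imB u p : cq_im (u - cq_of_quat p) = cq_im u.
Proof.
by apply/rowP => h; rewrite !mxE; case: (u 0 h) => a b /=; rewrite subr0.
Qed.

Lemma cq_eqP u w : cq_re u = cq_re w -> cq_im u = cq_im w -> u = w.
Proof.
move=> /rowP re_eq /rowP im_eq; apply/rowP => h.
move: (re_eq h) (im_eq h); rewrite !mxE.
by case: (u 0 h); case: (w 0 h) => /= ? ? ? ? -> ->.
Qed.

Lemma Re_dot u w :
  complex.Re (dot u w) = dot (cq_re u) (cq_re w) - dot (cq_im u) (cq_im w).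
Proof. by rewrite !dotE !(ReD, ReM) !mxE; ring. Qed.

Lemma Im_dot u w :
  complex.Im (dot u w) = dot (cq_re u) (cq_im w) + dot (cq_im u) (cq_re w).
Proof. by rewrite !dotE !(ImD, ImM) !mxE; ring. Qed.

Lemma complex_eq0P (x : R[i]) : complex.Re x = 0 -> complex.Im x = 0 -> x = 0.
Proof. by case: x => a b /= -> ->. Qed.

(** Writing n = w - p = d + sqrt(-1) w_1, the form at n is
    |d|^2 - |w_1|^2 + 2 sqrt(-1) <d, w_1>.  If it vanishes and w_1 != 0, the
    quaternion - d w_1^-1 is a purely imaginary unit. *)
Lemma ZconeP p w :
  Zcone p w <-> dot (w - cq_of_quat p) (w - cq_of_quat p) = 0.
Proof.
set n := w - _.
have nE : cq_re n = cq_re w - p by rewrite cq_reB.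
have nI : cq_im n = cq_im w by rewrite cq_imB.
split=> [[I /imag_unitsP[I0 I1] wp]|n0].
  have {}nE : cq_re n = - qmul I (cq_im w).
    by rewrite nE -wp /pi_CH opprD addrA subrr sub0r.
  apply: complex_eq0P; rewrite ?Re_dot ?Im_dot nE nI !(dotNl, dotNr).
    by rewrite opprK dot_qmul I1 mul1r subrr.
  by rewrite (dotC (cq_im w)) dot_qmul_id I0 mul0r oppr0 addr0.
have /eqP := congr1 (@complex.Re R) n0; rewrite Re_dot subr_eq0 nI => /eqP re0.
have := congr1 (@complex.Im R) n0.
rewrite Im_dot nI (dotC (cq_im w)) -mulr2n => /eqP.
rewrite mulrn_eq0 /= => /eqP im0.
have [w10|w1N0] := eqVneq (cq_im w) 0.
  (* w is the vertex p: any imaginary unit will do *)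
  exists (mkquat 0 1 0 0).
    by apply/imag_unitsP; rewrite dotE !mkquatE; split=> //; ring.
  have re_n : cq_re n = 0.
    by apply/eqP; rewrite -dot_eq0 re0 w10 dot_eq0.
  move/eqP: re_n; rewrite nE subr_eq0 /pi_CH w10 => /eqP ->.
  by rewrite -[X in qmul _ X](scale0r 0) qmulZr scale0r addr0.
have N0 : dot (cq_im w) (cq_im w) != 0 by rewrite dot_eq0.
(* the unit (p - w_0) w_1^-1, with w_1^-1 = conj(w_1) / |w_1|^2 *)
exists ((dot (cq_im w) (cq_im w))^-1 *: qmul (- cq_re n) (qconj (cq_im w))).
  apply/imag_unitsP; rewrite mxE qmulJ_re dotNl im0 oppr0 mulr0; split=> //.
  rewrite dotZl dotZr dot_qmul dotNl dotNr opprK dot_qconj re0.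
  by rewrite mulKf // mulVf.
rewrite /pi_CH qmulZl -qmulA qmulJr qmulZr scalerA mulVf // scale1r qmulr1.
by rewrite nE opprB addrC subrK.
Qed.

Lemma cq_re_conj n : cq_re (cq_conj n) = cq_re n.
Proof. by apply/rowP => h; rewrite !mxE; case: (n 0 h). Qed.

Lemma cq_im_conj n : cq_im (cq_conj n) = - cq_im n.
Proof. by apply/rowP => h; rewrite !mxE; case: (n 0 h). Qed.

Lemma dot_conj_eq0 n : dot n (cq_conj n) = 0 -> n = 0.
Proof.
move/(congr1 (@complex.Re R)); rewrite Re_dot cq_re_conj cq_im_conj dotNr opprK.
have dot_ge0 (q : 'rV[R]_4) : 0 <= dot q q.
  by apply: sumr_ge0 => h _; rewrite -expr2 sqr_ge0.
move/eqP; rewrite paddr_eq0 ?dot_ge0 // !dot_eq0 => /andP[/eqP re0 /eqP im0].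
by apply: cq_eqP; rewrite ?re0 ?im0; apply/rowP => h; rewrite !mxE.
Qed.

Lemma dot_conj n : dot n n = 0 -> dot (cq_conj n) (cq_conj n) = 0.
Proof.
move=> n0; apply: complex_eq0P.
  rewrite Re_dot cq_re_conj cq_im_conj dotNl dotNr opprK -Re_dot n0 //.
by rewrite Im_dot cq_re_conj cq_im_conj dotNl dotNr -opprD -Im_dot n0 oppr0.
Qed.

Section NullArc.
Variables (K : numFieldType) (n m u : 'rV[K]_4).
Hypotheses (n0 : dot n n = 0) (m0 : dot m m = 0) (nm : dot n m != 0).
Hypothesis un : dot u n = 0.

Let k := dot u m / dot n m.
Let c := - dot u u / (2 * dot n m).

(** An arc of null vectors starting at n with velocity u.  Correct the line
    n + t u by a multiple of a second null vector m with (n, m) != 0: if u' is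
    orthogonal to n and m, then n + t u' + t^2 c m is null for
    c = - (u', u') / 2 (n, m).  Here u' = u - k n, so (u', u') = (u, u), and the
    factor 1 + k t restores the velocity u' + k n = u.  The definition is the
    expansion of (1 + k t) (n + t u' + t^2 c m) in powers of t. *)
Definition null_arc (t : K^o) : 'rV[K]_4 :=
  n + t *: u + t ^+ 2 *: (c *: m + k *: (u - k *: n))
    + t ^+ 3 *: ((k * c) *: m).

Lemma null_arc_null t : dot (null_arc t) (null_arc t) = 0.
Proof.
have -> : null_arc t =
    (1 + k * t) *: (n + t *: (u - k *: n) + (t ^+ 2 * c) *: m).
  by apply: row4P; rewrite !mxE; ring.
rewrite !(dotZl, dotZr, dotDl, dotDr, dotNl, dotNr) (dotC n u) (dotC m n).
rewrite (dotC m u) n0 m0 un /c /k; field; exact: nm.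
Qed.

Lemma is_derive_scalel (s : K^o -> K^o) (ds t : K^o) (v : 'rV[K]_4) :
  is_derive t 1 s ds -> is_derive t 1 (fun x => s x *: v) (ds *: v).
Proof.
move=> ss; have sdiff : differentiable s t by apply/derivable1_diffP.
have vdiff := differentiableZl v sdiff.
apply: DeriveDef; first exact: diff_derivable.
by rewrite deriveE // diffZl // -deriveE // derive_val.
Qed.

Lemma is_derive_null_arc (t : K^o) : is_derive t 1 null_arc
  (u + (2 * t) *: (c *: m + k *: (u - k *: n))
     + (3 * t ^+ 2) *: ((k * c) *: m)).
Proof.
rewrite /null_arc; set u2 := c *: m + _; set u3 := (k * c) *: m.
have d1 : is_derive t 1 (fun x : K^o => x *: u) (1 *: u).
  exact: (is_derive_scalel u (is_derive_id t 1)).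
have d2 : is_derive t 1 (fun x : K^o => x ^+ 2 *: u2) ((2 * t) *: u2).
  apply: (@is_derive_scalel (fun x => x ^+ 2)).
  apply: (DeriveDef (@exprn_derivable K 2 t 1)).
  by rewrite exp_derive /GRing.scale /= mulr1.
have d3 : is_derive t 1 (fun x : K^o => x ^+ 3 *: u3) ((3 * t ^+ 2) *: u3).
  apply: (@is_derive_scalel (fun x => x ^+ 3)).
  apply: (DeriveDef (@exprn_derivable K 3 t 1)).
  by rewrite exp_derive /GRing.scale /= mulr1.
have := is_deriveD (is_deriveD (is_deriveD (is_derive_cst n t 1) d1) d2) d3.
by rewrite scale1r add0r.
Qed.

End NullArc.

(** The conjugate of n serves as the second null vector m, because (n, conj n)
    is the Hermitian square norm of n. *)
Lemma orthogonal_tangent p w u : Zcone p w -> w != cq_of_quat p ->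
  dot u (w - cq_of_quat p) = 0 -> tangent_space (Zcone p) w u.
Proof.
set n := w - cq_of_quat p => /ZconeP n0 wp un.
have nm : dot n (cq_conj n) != 0.
  by apply: contra_neq wp => /dot_conj_eq0 /eqP; rewrite subr_eq0 => /eqP.
pose g := null_arc n (cq_conj n) u.
have dg (t : Cplx R) := is_derive_null_arc n (cq_conj n) u t.
exists (fun t => cq_of_quat p + g t); split.
- by rewrite /g /null_arc !expr0n /= !scale0r !addr0 addrC subrK.
- near=> t; split; first by apply: derivableD.
  by apply/ZconeP; rewrite addrC addKr; apply: null_arc_null; rewrite ?dot_conj.
- have := is_deriveD (is_derive_cst (cq_of_quat p) (0 : Cplx R) 1) (dg 0).
  by rewrite !expr0n /= !mulr0 !scale0r !addr0 add0r.
Unshelve. all: by end_near.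
Qed.

End Cone.

(** * The kernel of the differential of a slice function *)

Section Kernel.
Variable R : realType.
Local Open Scope complex_scope.
Implicit Types (I v : 'rV[R]_4) (u w : 'rV[R[i]]_4).

(** For u = F'(z), w1 = F_1(z) and b = Im z this is Df_q v at q = pi(z, I).  The
    complex number v_0 + sqrt(-1) <v, I> is the increment of z, and
    v - v_0 - <v, I> I is the component of v orthogonal to 1 and I. *)
Definition slice_diff I (b : R) u (w1 : 'rV[R]_4) v : 'rV[R]_4 :=
  pi_CH ((v 0 0 +i* dot v I) *: u) I
  + b^-1 *: qmul (v - v 0 0 *: qone R - dot v I *: I) w1.

(** pi(., I) turns multiplication by sqrt(-1) into left multiplication by I. *)
Lemma pi_CH_Z I (a b : R) u : imag_units I ->
  pi_CH ((a +i* b) *: u) I = a *: pi_CH u I + b *: qmul I (pi_CH u I).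
Proof.
move=> II; rewrite /pi_CH cq_reZ cq_imZ /= !(qmulDr, qmulZr) qmulA II qmulN1.
by rewrite !scalerDr scalerN -!addrA; congr (_ + _); rewrite addrC -addrA.
Qed.

(** Pairing the equation (a + cI) A + b^-1 y w1 = 0 with w1 and with I w1 kills
    the second term and leaves a rotation-dilation of determinant a^2 + c^2
    applied to the two wanted scalar products. *)
Lemma slice_diff_kernel I b u (w1 : 'rV[R]_4) v :
  imag_units I -> b != 0 -> w1 != 0 -> v != 0 -> slice_diff I b u w1 v = 0 ->
  dot (pi_CH u I) w1 = 0 /\ dot (pi_CH u I) (qmul I w1) = 0.
Proof.
move=> II b0 w10 v0; rewrite /slice_diff pi_CH_Z //.
have [I0 I1] := (imag_unitsP I).1 II.
set A := pi_CH u I; set a := v 0 0; set c := dot v I.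
set y := v - _ - _; set B := b^-1 *: _ => L0.
have qone0 : qone R 0 0 = 1 by rewrite /qone mkquatE.
have dot1 p : dot (qone R) p = p 0 0.
  by rewrite dotE /qone !mkquatE; ring.
have y0 : y 0 0 = 0.
  have -> : y 0 0 = v 0 0 - v 0 0 * qone R 0 0 - c * I 0 0 by rewrite !mxE.
  by rewrite I0 qone0 mulr1 mulr0 subr0 subrr.
have yI : dot y I = 0.
  by rewrite !(dotDl, dotNl, dotZl) dot1 I0 I1 mulr0 subr0 mulr1 subrr.
have B1 : dot B w1 = 0 by rewrite dotZl dot_qmul_id y0 mul0r mulr0.
have B2 : dot B (qmul I w1) = 0 by rewrite dotZl dot_qmulr yI mul0r mulr0.
set X := dot A w1; set Y := dot A (qmul I w1).
have eq1 : a * X - c * Y = 0.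
  have := congr1 (fun p => dot p w1) L0.
  rewrite dotDl B1 addr0 dotDl !dotZl (dot_qmul_im _ _ I0) mulrN => ->.
  by rewrite -[X in dot X](scale0r 0) dotZl mul0r.
have eq2 : a * Y + c * X = 0.
  have := congr1 (fun p => dot p (qmul I w1)) L0.
  rewrite dotDl B2 addr0 dotDl !dotZl dot_qmull I1 mul1r => ->.
  by rewrite -[X in dot X](scale0r 0) dotZl mul0r.
(* if a = c = 0 then y w1 = 0, hence y = 0 and v = 0 *)
have ac0 : a ^+ 2 + c ^+ 2 != 0.
  apply: contra_neq v0 => /eqP.
  rewrite paddr_eq0 ?sqr_ge0 // !sqrf_eq0 => /andP[/eqP a0 /eqP c0].
  move: L0; rewrite a0 c0 !scale0r !add0r => /eqP.
  rewrite scaler_eq0 invr_eq0 (negPf b0) /= -dot_eq0 dot_qmul mulf_eq0.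
  rewrite !dot_eq0 (negPf w10) orbF /y -/a a0 c0 !scale0r !subr0.
  by move/eqP.
split; apply/eqP; rewrite -(mulrI_eq0 _ (mulfI ac0)); apply/eqP.
  transitivity (a * (a * X - c * Y) + c * (a * Y + c * X)); first by ring.
  by rewrite eq1 eq2 !mulr0 addr0.
transitivity (a * (a * Y + c * X) - c * (a * X - c * Y)); first by ring.
by rewrite eq1 eq2 !mulr0 subr0.
Qed.

(** Since w - pi(w, I) = (sqrt(-1) - I) w_1, left multiplication by I, an
    isometry, gathers the two components of u into pi(u, I). *)
Lemma dot_cone I u w : imag_units I ->
  dot (pi_CH u I) (cq_im w) = 0 -> dot (pi_CH u I) (qmul I (cq_im w)) = 0 ->
  dot u (w - cq_of_quat (pi_CH w I)) = 0.
Proof.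
move=> II X0 Y0; have [I0 I1] := (imag_unitsP I).1 II.
set n := w - _.
have nE : cq_re n = - qmul I (cq_im w).
  by rewrite cq_reB /pi_CH opprD addrA subrr sub0r.
have nI : cq_im n = cq_im w by rewrite cq_imB.
apply: complex_eq0P; rewrite ?Re_dot ?Im_dot nE nI dotNr.
  move: Y0; rewrite dotDl dot_qmull I1 mul1r => Y0.
  by rewrite -opprD Y0 oppr0.
by rewrite -dot_qmul_im // -dotDl.
Qed.

End Kernel.

(** * Computing differentials *)

Section Differentials.
Variable K : numFieldType.
Implicit Types V W : normedModType K.

Lemma is_diff_eps V W (f df : V -> W) (x : V) : linear df -> continuous df ->
  (forall e, 0 < e ->
     \forall h \near (0 : V), `|f (h + x) - f x - df h| <= e * `|h|) ->
  is_diff x f df.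
Proof.
move=> dfl dfc dfe.
pose dfM := GRing.isLinear.Build _ _ _ _ _ dfl.
pose dfL : {linear V -> W} := HB.pack df dfM.
have fE : f \o shift x = cst (f x) + dfL +o_ 0 id.
  apply/eqaddoP => e e0; near=> h.
  rewrite [_ h](_ : _ = f (h + x) - f x - df h); first by near: h; exact: dfe.
  by rewrite !fctE opprD addrA.
have dE : 'd f x = df :> (V -> W) by apply: (@diff_unique _ _ _ _ dfL).
apply: DiffDef => //; apply/diff_locallyP; rewrite dE; split=> //.
Unshelve. all: by end_near.
Qed.

Lemma diff_eps V W (f : V -> W) (x : V) (e : K) : differentiable f x -> 0 < e ->
  \forall h \near (0 : V), `|f (h + x) - f x - 'd f x h| <= e * `|h|.
Proof.
move=> /diff_locally /eqaddoP/(_ e) + e0 => /(_ e0).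
by apply: filterS => h; rewrite !fctE opprD addrA.
Qed.

(** Differentials are local. *)
Lemma is_diff_near V W (f g df : V -> W) (x : V) :
  (\forall y \near x, g y = f y) -> is_diff x f df -> is_diff x g df.
Proof.
move=> gf fd; have dfE : 'd f x = df :> (V -> W) by rewrite diff_val.
rewrite -dfE.
have fdiff : differentiable f x by [].
apply: is_diff_eps.
- exact: linearP.
- exact: diff_continuous.
- move=> e e0; have := diff_eps fdiff e0.
  have gfx : g x = f x by exact: nbhs_singleton gf.
  have gf0 : \forall h \near (0 : V), g (h + x) = f (h + x).
    by have := gf; rewrite (near_shift 0 x) subr0.
  by apply: filterS2 gf0 => h ->; rewrite gfx.
Qed.

Lemma is_diff_ext V W (f g df dg : V -> W) (x : V) :
  f =1 g -> df =1 dg -> is_diff x f df -> is_diff x g dg.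
Proof. by move=> /funext <- /funext <-. Qed.

Lemma is_diff_coord V n (f df : V -> 'rV[K]_n) (x : V) (j : 'I_n) :
  is_diff x f df -> is_diff x (fun y => f y 0 j) (fun v => df v 0 j).
Proof.
move=> fd; pose cj := (fun M : 'rV[K]_n => M 0 j).
have cd : is_diff (f x) cj cj.
  apply: is_diff_eps.
  - by move=> a M N; rewrite /cj !mxE.
  - exact: coord_continuous.
  - move=> e e0; near=> h.
    by rewrite /cj !mxE addrK subrr normr0 mulr_ge0 // ltW.
exact: (is_diff_comp fd cd).
Unshelve. all: by end_near.
Qed.

Lemma is_diff_row V n (f df : V -> 'rV[K]_n) (x : V) :
  (forall j, is_diff x (fun y => f y 0 j) (fun v => df v 0 j)) ->
  is_diff x f df.
Proof.
move=> fd.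
have fdiff : differentiable f x.
  have -> : f = \sum_(j < n) (fun y => f y 0 j *: delta_mx 0 j).
    by apply/funext => y; rewrite fct_sumE -row_sum_delta.
  apply: differentiable_sum => j; apply: differentiableZl.
  by have := fd j => ?.
apply: DiffDef => //; apply/funext => v; apply/rowP => j.
have := is_diff_coord j (differentiableP fdiff) => fdj.
have dfjE : 'd (fun y => f y 0 j) x = (fun v => df v 0 j) :> (V -> K).
  by have := fd j => ?; rewrite diff_val.
transitivity ('d (fun y => f y 0 j) x v); last by rewrite dfjE.
by rewrite diff_val.
Qed.

Lemma coord_norm n (u : 'rV[K]_n) (j : 'I_n) : `|u 0 j| <= `|u|.
Proof.
rewrite [leRHS]/Num.norm /= mx_normE.
set M := \big[_/_]_i _; have : M <= M by [].
by move=> /bigmax_leP[_ /(_ (0, j) isT)]; rewrite -num_le.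
Qed.

End Differentials.

(** * The real differential of a holomorphic map *)

Section RealDifferential.
Variable R : realType.
Local Open Scope complex_scope.

Definition cplx (p : R * R) : Cplx R := p.1 +i* p.2.

(** The product R * R carries the maximum norm. *)
Lemma norm_cplx (p : R * R) : `|cplx p| <= (2 * `|p|)%:C.
Proof.
rewrite normc_def lecR /=.
have p1 : `|p.1| <= `|p| by rewrite /Num.norm /= le_max lexx.
have p2 : `|p.2| <= `|p| by rewrite /Num.norm /= le_max lexx orbT.
rewrite -[leRHS]ger0_norm; last by rewrite mulr_ge0.
rewrite -sqrtr_sqr ler_wsqrtr // exprMn.
rewrite -[p.1 ^+ 2]real_normK ?num_real // -[p.2 ^+ 2]real_normK ?num_real //.
have sq a : 0 <= a -> a <= `|p| -> a ^+ 2 <= `|p| ^+ 2.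
  by move=> a0 ap; rewrite lerXn2r ?nnegrE.
have := sq _ (normr_ge0 _) p1; have := sq _ (normr_ge0 _) p2.
have := sqr_ge0 `|p|; nra.
Qed.

Lemma cplxD (p q : R * R) : cplx (p + q) = cplx p + cplx q.
Proof. by []. Qed.

Lemma cplx_near0 (P : Cplx R -> Prop) :
  (\forall h \near (0 : Cplx R), P h) ->
  \forall p \near (0 : (R * R)%type), P (cplx p).
Proof.
move=> /nbhs_normP[/= d d0 dP].
have d0' : 0 < complex.Re d by move: d0; rewrite ltcE /= => /andP[].
have dE : d = (complex.Re d)%:C by rewrite RRe_real // gtr0_real.
near=> p; apply: dP => /=; rewrite sub0r normrN.
apply: (le_lt_trans (norm_cplx p)); rewrite dE ltcR mulrC -ltr_pdivlMr //.
near: p; apply: (@nbhs0_lt R (R * R)%type (complex.Re d / 2)).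
by rewrite divr_gt0.
Unshelve. all: by end_near.
Qed.

(** A common statement for the real and the imaginary part psi.  The normed
    modules on the two sides are over different fields, R and R[i], so the
    differential is transferred through its epsilon form. *)
Lemma is_diff_complex (F : Cplx R -> 'rV[R[i]]_4) (p : R * R) (j : 'I_4)
    (psi : R[i] -> R) :
  (forall x y, psi (x + y) = psi x + psi y) ->
  (forall a x, psi (a%:C * x) = a * psi x) ->
  (forall x, `|psi x|%:C <= `|x|) ->
  differentiable F (cplx p) ->
  is_diff p (fun q => psi (F (cplx q) 0 j))
            (fun q => psi ((cplx q *: 'd F (cplx p) 1) 0 j)).
Proof.
move=> psiD psiZ psi_le Fd; set u := 'd F (cplx p) 1.
have psiB x y : psi (x - y) = psi x - psi y.
  by apply/eqP; rewrite eq_sym subr_eq -psiD subrK.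
have psiE (q : R * R) :
    psi ((cplx q *: u) 0 j) = q.1 * psi (u 0 j) + q.2 * psi ('i * u 0 j).
  rewrite mxE -!psiZ -psiD mulrA -mulrDl; congr (psi (_ * _)).
  by rewrite /cplx; simpc.
have dFE (h : Cplx R) : 'd F (cplx p) h = h *: u.
  by rewrite -linearZ /=; congr ('d F _ _); rewrite /GRing.scale /= mulr1.
apply: is_diff_eps.
- by move=> a q r; rewrite !psiE /= /GRing.scale /=; ring.
- have -> : (fun q => psi ((cplx q *: u) 0 j)) =
      (fun q => q.1 * psi (u 0 j) + q.2 * psi ('i * u 0 j)).
    exact/funext.
  move=> q; apply: cvgD; apply: cvgM; try exact: cvg_cst.
    exact: cvg_fst.
  exact: cvg_snd.
- move=> e e0.
  have e20 : 0 < (e / 2)%:C :> R[i] by rewrite ltcR divr_gt0.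
  have := cplx_near0 (diff_eps Fd e20).
  apply: filterS => h Fh.
  rewrite -!psiB -lecR; apply: (le_trans (psi_le _)).
  set w := F (cplx h + cplx p) - F (cplx p) - 'd F (cplx p) (cplx h).
  have -> : F (cplx (h + p)) 0 j - F (cplx p) 0 j - (cplx h *: u) 0 j = w 0 j.
    by rewrite /w dFE cplxD !mxE.
  apply: (le_trans (coord_norm _ _)); apply: (le_trans Fh).
  rewrite (le_trans (ler_wpM2l (ltW e20) (norm_cplx h))) //.
  by rewrite -rmorphM /= lecR mulrA divfK.
Qed.

Lemma is_diff_cq_re (F : Cplx R -> 'rV[R[i]]_4) (p : R * R) :
  differentiable F (cplx p) ->
  is_diff p (fun q => cq_re (F (cplx q)))
            (fun q => cq_re (cplx q *: 'd F (cplx p) 1)).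
Proof.
move=> Fd; apply: is_diff_row => j.
have ReZ (a : R) (x : R[i]) : complex.Re (a%:C * x) = a * complex.Re x.
  by rewrite ReM /= mul0r subr0.
have := is_diff_complex j (@ReD R) ReZ (@normc_ge_Re R) Fd.
by apply: is_diff_ext => q; rewrite [RHS]mxE.
Qed.

Lemma is_diff_cq_im (F : Cplx R -> 'rV[R[i]]_4) (p : R * R) :
  differentiable F (cplx p) ->
  is_diff p (fun q => cq_im (F (cplx q)))
            (fun q => cq_im (cplx q *: 'd F (cplx p) 1)).
Proof.
move=> Fd; apply: is_diff_row => j.
have ImZ (a : R) (x : R[i]) : complex.Im (a%:C * x) = a * complex.Im x.
  by rewrite ImM /= mul0r addr0.
have normc_ge_Im (x : R[i]) : `|complex.Im x|%:C <= `|x|.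
  rewrite normc_def lecR -sqrtr_sqr ler_wsqrtr //.
  by rewrite lerDr sqr_ge0.
have := is_diff_complex j (@ImD R) ImZ normc_ge_Im Fd.
by apply: is_diff_ext => q; rewrite [RHS]mxE.
Qed.

Lemma is_diff_qmul (V : normedModType R) (f g df dg : V -> 'rV[R]_4) (x : V) :
  is_diff x f df -> is_diff x g dg ->
  is_diff x (fun y => qmul (f y) (g y))
            (fun v => qmul (df v) (g x) + qmul (f x) (dg v)).
Proof.
move=> fd gd.
have fj j := is_diff_coord j fd; have gj j := is_diff_coord j gd.
have fg i j : is_diff x (fun y => f y 0 i * g y 0 j)
    (fun v => f x 0 i * dg v 0 j + g x 0 j * df v 0 i).
  exact: is_diffM.
apply: is_diff_row; apply: forall_ord4.
- have := is_diffB (is_diffB (is_diffB (fg 0 0) (fg 1 1)) (fg 2 2)) (fg 3 3).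
  by apply: is_diff_ext => y; rewrite !fctE /qmul !(mxE, mkquatE) /=; ring.
- have := is_diffB (is_diffD (is_diffD (fg 0 1) (fg 1 0)) (fg 2 3)) (fg 3 2).
  by apply: is_diff_ext => y; rewrite !fctE /qmul !(mxE, mkquatE) /=; ring.
- have := is_diffD (is_diffD (is_diffB (fg 0 2) (fg 1 3)) (fg 2 0)) (fg 3 1).
  by apply: is_diff_ext => y; rewrite !fctE /qmul !(mxE, mkquatE) /=; ring.
- have := is_diffD (is_diffB (is_diffD (fg 0 3) (fg 1 2)) (fg 2 1)) (fg 3 0).
  by apply: is_diff_ext => y; rewrite !fctE /qmul !(mxE, mkquatE) /=; ring.
Qed.

End RealDifferential.

(** * Slice coordinates of a quaternion *)

Section SliceCoordinates.
Variable R : realType.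
Local Open Scope complex_scope.
Implicit Types x v I : 'rV[R]_4.

Definition im2 x : R := x 0 1 ^+ 2 + x 0 2 ^+ 2 + x 0 3 ^+ 2.

(** A non-real x is pi(z, J) for exactly two pairs (z, J), exchanged by
    (z, J) -> (conj z, -J).  The sign s of Im z selects one of them. *)
Definition slice_im (s : R) x : R := s * Num.sqrt (im2 x).

Definition slice_z s x : R * R := (x 0 0, slice_im s x).

Definition slice_unit s x : 'rV[R]_4 :=
  (slice_im s x)^-1 *: (x - x 0 0 *: qone R).

Lemma slice_coordP s x : s ^+ 2 = 1 -> slice_im s x != 0 ->
  imag_units (slice_unit s x)
  /\ pi_C (cplx (slice_z s x)) (slice_unit s x) = x.
Proof.
move=> s1 r0; split.
  apply/imag_unitsP; split.
    by rewrite /slice_unit /qone !(mxE, mkquatE) /=; ring.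
  have -> : dot (slice_unit s x) (slice_unit s x) = im2 x / slice_im s x ^+ 2.
    rewrite dotE /slice_unit /qone !(mxE, mkquatE) /= /im2.
    by field.
  rewrite [X in _ / X]exprMn s1 mul1r sqr_sqrtr.
    by rewrite divff //; apply: contra_neq r0; rewrite /slice_im => ->;
      rewrite sqrtr0 mulr0.
  by rewrite !addr_ge0 ?sqr_ge0.
by rewrite /pi_C /slice_unit /= scalerA divff // scale1r addrC subrK.
Qed.

Section AtPoint.
Variables (z : Cplx R) (I : 'rV[R]_4).
Hypotheses (II : imag_units I) (z_im : complex.Im z != 0).
Let q := pi_C z I.
Let b := complex.Im z.
Let s := Num.sg b.

Let I00 : I 0 0 = 0. Proof. by case: ((imag_unitsP I).1 II). Qed.

Lemma im2_pi_C : im2 q = b ^+ 2.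
Proof.
have [_] := (imag_unitsP I).1 II; rewrite dotE I00 /q /im2 => I1.
rewrite /pi_C /qone !(mxE, mkquatE) /= -/b.
transitivity (b ^+ 2 * (0 * 0 + I 0 1 * I 0 1 + I 0 2 * I 0 2 + I 0 3 * I 0 3)).
  by ring.
by rewrite I1 mulr1.
Qed.

Lemma slice_im_pi_C : slice_im s q = b.
Proof. by rewrite /slice_im im2_pi_C sqrtr_sqr -numEsg. Qed.

Lemma slice_z_pi_C : cplx (slice_z s q) = z.
Proof.
rewrite /cplx /slice_z /= slice_im_pi_C /q /pi_C /qone !(mxE, mkquatE) /= I00.
by rewrite mulr1 mulr0 addr0 /b; case: (z).
Qed.

Lemma slice_unit_pi_C : slice_unit s q = I.
Proof.
rewrite /slice_unit slice_im_pi_C.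
have -> : q - q 0 0 *: qone R = b *: I.
  apply: row4P; rewrite /q /pi_C /qone !(mxE, mkquatE) /= ?I00 /b; ring.
by rewrite scalerA mulVf // scale1r.
Qed.

Lemma is_diff_id_coord j : is_diff q (fun x => x 0 j) (fun v => v 0 j).
Proof. exact: is_diff_coord (is_diff_id q). Qed.

Lemma is_diff_sqrt (a : R) : 0 < a ->
  is_diff a (@Num.sqrt R) (fun h => h / (2 * Num.sqrt a)).
Proof.
move=> a0; have da := is_derive1_sqrt a0.
have sd : differentiable (@Num.sqrt R) a by apply/derivable1_diffP.
apply: DiffDef => //; apply/funext => h.
by rewrite diff1E // derive1E derive_val.
Qed.

(** |Im x| has gradient s I at q, and s^2 = 1. *)
Lemma is_diff_slice_im : is_diff q (slice_im s) (fun v => dot v I).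
Proof.
have c j := is_diff_id_coord j.
have sq j := is_diffM (c j) (c j).
have im2d : is_diff q im2 (fun v => 2 * b * dot v I).
  have := is_diffD (is_diffD (sq 1) (sq 2)) (sq 3).
  apply: is_diff_ext => v; first by rewrite /im2 !expr2.
  rewrite !fctE /q /pi_C /qone dotE I00 !(mxE, mkquatE) /= -/b /GRing.scale /=.
  by ring.
have b20 : 0 < im2 q by rewrite im2_pi_C exprn_even_gt0.
have := is_diffZ s (is_diff_comp im2d (is_diff_sqrt b20)).
apply: is_diff_ext => // v; rewrite /= !fctE /= im2_pi_C sqrtr_sqr.
have bE : b = s * `|b| by rewrite -numEsg.
have nb0 : `|b| != 0 by rewrite normr_eq0.
have s2 : s * s = 1 by rewrite -expr2 sqr_sg z_im.
rewrite /GRing.scale /= {1}bE.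
transitivity (s * s * dot v I); last by rewrite s2 mul1r.
by field.
Qed.

Lemma is_diff_slice_z : is_diff q (slice_z s) (fun v => (v 0 0, dot v I)).
Proof. exact: is_diff_pair (is_diff_id_coord 0) is_diff_slice_im. Qed.

Lemma is_diff_slice_unit : is_diff q (slice_unit s)
  (fun v => b^-1 *: (v - v 0 0 *: qone R - dot v I *: I)).
Proof.
have r0 : slice_im s q != 0 by rewrite slice_im_pi_C.
have inv : is_diff q (fun x => (slice_im s x)^-1) (fun v => - b ^- 2 * dot v I).
  have rd := is_diff_slice_im.
  apply: DiffDef; first exact: differentiableV.
  apply/funext => v; rewrite diffV // slice_im_pi_C.
  by rewrite diff_val.
apply: is_diff_row => j.
have := is_diffM inv
  (is_diffB (is_diff_id_coord j) (is_diffZ (qone R 0 j) (is_diff_id_coord 0))).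
apply: is_diff_ext => v.
  by rewrite /= !fctE /= [RHS]mxE [X in _ = _ * X]mxE [X in _ = _ * (_ + X)]mxE
     [X in _ = _ * (_ - X)]mxE /GRing.scale /= (mulrC (qone R 0 j)).
have qj : q 0 j - qone R 0 j * q 0 0 = b * I 0 j.
  have -> : q 0 0 = complex.Re z.
    by rewrite /q /pi_C /qone !(mxE, mkquatE) /= I00 mulr1 mulr0 addr0.
  rewrite /q /pi_C [X in X - _]mxE [X in X + _ - _]mxE [X in _ + X - _]mxE -/b.
  by ring.
rewrite /= !fctE /= /GRing.scale /= slice_im_pi_C qj.
rewrite [RHS]mxE [X in _ = _ * X]mxE [X in _ = _ * (X + _)]mxE
  [X in _ = _ * (_ + X + _)]mxE [X in _ = _ * (_ + X)]mxE.
rewrite [X in _ = _ * (_ - X + _)]mxE [X in _ = _ * (_ - X)]mxE.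
by field.
Qed.

End AtPoint.

End SliceCoordinates.

(** * The differential of a slice regular function *)

Section SliceDifferential.
Variable R : realType.
Local Open Scope complex_scope.

Lemma near_slice_z (U : set (Cplx R)) (z : Cplx R) (I : 'rV[R]_4) :
  imag_units I -> complex.Im z != 0 -> open U -> U z ->
  \forall x \near pi_C z I, U (cplx (slice_z (Num.sg (complex.Im z)) x)).
Proof.
move=> II z_im Uo Uz; set s := Num.sg _; set q := pi_C z I.
have zc : {for q, continuous (slice_z s)}.
  apply: differentiable_continuous.
  by have := is_diff_slice_z II z_im => ?.
have : \forall h \near (0 : Cplx R), U (h + z).
  have : \forall w \near z, U w by exact: open_nbhs_nbhs.
  by rewrite (near_shift (0 : Cplx R) z) subr0.
move=> /cplx_near0 U0.
have {}U0 : \forall p \near slice_z s q, U (cplx p).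
  rewrite (near_shift (0 : (R * R)%type) (slice_z s q)) subr0.
  by apply: filterS U0 => p; rewrite /= cplxD (slice_z_pi_C z II).
exact: zc U0.
Qed.

(** Near q, f(x) = F_0(z(x)) + J(x) F_1(z(x)) with (z(x), J(x)) the slice
    coordinates of x.  The Leibniz rule gives F_0' + I F_1', which is the first
    term of [slice_diff], plus J'(v) F_1, the second one. *)
Lemma is_diff_slice_regular (U : set (Cplx R)) (F : Cplx R -> 'rV[R[i]]_4)
    (f : 'rV[R]_4 -> 'rV[R]_4) (z : Cplx R) (I : 'rV[R]_4) :
  open U -> induces U F f -> derivable F z 1 -> U z -> imag_units I ->
  complex.Im z != 0 ->
  is_diff (pi_C z I) f
    (slice_diff I (complex.Im z) ('d F z 1) (cq_im (F z))).
Proof.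
move=> Uo Ff Fd Uz II z_im; set q := pi_C z I; set b := complex.Im z.
pose s := Num.sg b.
have s2 : s ^+ 2 = 1 by rewrite sqr_sg z_im.
have qz : cplx (slice_z s q) = z by exact: slice_z_pi_C.
have zd : is_diff q (slice_z s) _ := is_diff_slice_z II z_im.
have Fdq : differentiable F (cplx (slice_z s q)).
  by rewrite qz; apply/derivable1_diffP.
have red := is_diff_comp zd (is_diff_cq_re Fdq).
have imd := is_diff_comp zd (is_diff_cq_im Fdq).
have ud := is_diff_slice_unit II z_im.
have gd := is_diffD red (is_diff_qmul ud imd).
pose g x := pi_CH (F (cplx (slice_z s x))) (slice_unit s x).
have {}gd : is_diff q g (slice_diff I b ('d F z 1) (cq_im (F z))).
  apply: is_diff_ext gd => // v.
  rewrite !fctE /= qz (slice_unit_pi_C II z_im) /slice_diff /pi_CH.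
  by rewrite qmulZl [LHS]addrA [LHS]addrAC.
apply: (is_diff_near _ gd).
have r0 : \forall x \near q, slice_im s x != 0.
  have rc : {for q, continuous (slice_im s)}.
    apply: differentiable_continuous.
    by have := is_diff_slice_im II z_im => ?.
  have := cvgr_neq0 _ rc; apply.
  by rewrite (slice_im_pi_C z II).
have Ux := near_slice_z II z_im Uo Uz.
apply: filterS2 r0 Ux => x rx Ux.
have [Ju xE] := slice_coordP s2 rx.
by rewrite -[in LHS]xE Ff.
Qed.

End SliceDifferential.

(** * Singular points and tangency *)

Theorem lemma3p1 (R : realType) (U : set (Cplx R)) (F : Cplx R -> cquat R)
    (f : quat R -> quat R) (z : Cplx R) (I : quat R) :
  open U -> conj_invariant U -> slice_regular U F f ->
  U z -> imag_units I ->
  complex.Im z != 0 -> cq_im (F z) != 0 ->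
  'J f (pi_C z I) \notin unitmx ->
  tangent_at F (f (pi_C z I)) z.
Proof.
move=> Uo _ [_ Fhol Ff] Uz II z_im Fz_im Jsing.
have fd := is_diff_slice_regular Uo Ff (Fhol z Uz) Uz II z_im.
have fdE : 'd f (pi_C z I) =
    slice_diff I (complex.Im z) ('d F z 1) (cq_im (F z)) :> (_ -> _).
  by rewrite diff_val.
have [v v0 Lv0] : exists2 v, v != 0 &
    slice_diff I (complex.Im z) ('d F z 1) (cq_im (F z)) v = 0.
  move: Jsing; rewrite unitmxE unitfE negbK => /det0P[v v0 vJ].
  by exists v => //; rewrite -fdE -vJ /jacobian mul_rV_lin1.
have [X0 Y0] := slice_diff_kernel II z_im Fz_im v0 Lv0.
have fq : f (pi_C z I) = pi_CH (F z) I by exact: Ff.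
have Fz : Zcone (f (pi_C z I)) (F z) by exists I.
have FzN : F z != cq_of_quat (f (pi_C z I)).
  apply: contra_neq Fz_im => Fzp.
  rewrite -(cq_imB _ (f (pi_C z I))) Fzp subrr.
  by apply/rowP => h; rewrite !mxE.
split=> // v'; apply: orthogonal_tangent => //.
have -> : 'd F z v' = v' *: 'd F z 1.
  by rewrite -linearZ /=; congr ('d F _ _); rewrite /GRing.scale /= mulr1.
by rewrite dotZl fq dot_cone // mulr0.
Qed.
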